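(* Let $B=B_0\oplus B_1$ be a Bol superalgebra with Killing-Ricci form $\beta$. Then (1) $\beta(x,y)=(-1)^{\bar x\bar y}\beta(y,x)$ for all $x,y\in B_0\cup B_1$; (2) $\beta(B_0,B_1)=0$; (3) $\beta(A(x),A(y))=\beta(x,y)$ for all $x,y\in B$ and all $A\in\mathrm{Aut}(B)$; (4) $\beta([x,y,z],u)=-(-1)^{\bar z(\bar x+\bar y)}\beta(z,[x,y,u])$ for all $x,y,z,u\in B_0\cup B_1$.
   Context: All vector superspaces and superalgebras are finite dimensional over a fixed field $\mathbb{K}$ of characteristic $0$; $\bar x\in\mathbb{Z}_2$ denotes the parity of a homogeneous element $x$. A Bol superalgebra is a superspace $B=B_0\oplus B_1$ with a bilinear operation $(x,y)\mapsto x\cdot y=xy$, $B_i\cdot B_j\subseteq B_{i+j}$, and a trilinear operation $[\,,\,,\,]$, $[B_i,B_j,B_k]\subseteq B_{i+j+k}$, such that for all homogeneous $x,y,z,u,v,w$: (BS1) $x\cdot y=-(-1)^{\bar x\bar y}y\cdot x$; (BS2) $[x,y,z]=-(-1)^{\bar x\bar y}[y,x,z]$; (BS3) $[x,y,z]+(-1)^{\bar x(\bar y+\bar z)}[y,z,x]+(-1)^{\bar z(\bar x+\bar y)}[z,x,y]=0$; (BS4) $[x,y,[u,v,w]]=[[x,y,u],v,w]+(-1)^{\bar u(\bar x+\bar y)}[u,[x,y,v],w]+(-1)^{(\bar x+\bar y)(\bar u+\bar v)}[u,v,[x,y,w]]$; (BS5) $[x,y,u\cdot v]=(-1)^{\bar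 u(\bar x+\bar y)}u\cdot[x,y,v]+[x,y,u]\cdot v+(-1)^{(\bar x+\bar y)(\bar u+\bar v)}[u,v,x\cdot y]+(x\cdot y)\cdot(u\cdot v)$. A morphism of Bol superalgebras is an even linear map $f$ with $f(xy)=f(x)f(y)$ and $f([x,y,z])=[f(x),f(y),f(z)]$; $\mathrm{Aut}(B)$ is the group of bijective morphisms $B\to B$. A linear map $P:B\to B$ of degree $r\in\mathbb{Z}_2$ is a pseudo superderivation with companion $a\in B_r$ if for all homogeneous $x,y,z$: $P([x,y,z])=[P(x),y,z]+(-1)^{r\bar x}[x,P(y),z]+(-1)^{r(\bar x+\bar y)}[x,y,P(z)]$ and $P(xy)=(-1)^{r\bar x}xP(y)+P(x)y+(-1)^{r(\bar x+\bar y)}[x,y,a]+a\cdot xy$. $\mathrm{Com}(P)$ is the set of companions of $P$. For homogeneous $x,y$, $D_{x,y}(z)=[x,y,z]$ is a pseudo superderivation of degree $\bar x+\bar y$ with companion $xy$. Let $ipS_r(B,B)$ be the span of all $D_{x,y}$ with $x,y$ homogeneous, $\bar x+\bar y=r$; let $IPS_r(B,B)=\{(P,c):P\in ipS_r(B,B),\ c\in\mathrm{Com}(P)\}$ and $IPS(B,B)=IPS_0(B,B)\oplus IPS_1(B,B)$. The standard enveloping Lie superalgebra of $B$ is $L(B)=B\oplus IPS(B,B)$, graded by $L(B)_i=B_i\oplus IPS_i(B,B)$, with bracket (bilinear), for homogeneous $x,y\in B$ and $(P,a)\in IPS_r(B,B)$, $(Q,b)\in IPS_s(B,B)$: $[x,y]=(D_{x,y},xy)$;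 $[(P,a),x]=-(-1)^{r\bar x}[x,(P,a)]=P(x)$; $[(P,a),(Q,b)]=(PQ-(-1)^{rs}QP,\ P(b)-(-1)^{rs}Q(a)-ab)$. It is a Lie superalgebra. Its Killing form is $\alpha(u,v)=\mathrm{str}(\mathrm{ad}\,u\circ\mathrm{ad}\,v)$ ($\mathrm{str}$ = supertrace). The Killing-Ricci form $\beta$ of $B$ is the restriction of $\alpha$ to $B\times B$. *)

(* Defs.v *)
From HB Require Import structures.
From mathcomp Require Import all_boot all_order all_algebra boolp ring.

Set Implicit Arguments.
Unset Strict Implicit.
Unset Printing Implicit Defensive.

Import GRing.Theory.

Local Open Scope ring_scope.

(* Parities are booleans: [true] is odd, [(+)] is the sum and [&&] the product
   of Z/2, so that (-1) ^+ (i && j) is the usual Koszul sign. *)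

Lemma coord_inj (K : fieldType) (V : vectType K) (u v : V) :
  (forall q, coord (vbasis {:V}) q u = coord (vbasis {:V}) q v) -> u = v.
Proof.
move=> uv; rewrite (coord_vbasis (memvf u)) (coord_vbasis (memvf v)).
by apply: eq_bigr => q _; rewrite uv.
Qed.

Section LfunLinear.
Variables (K : fieldType) (U V W : vectType K).
Implicit Types (f g : 'Hom(U, V)) (h : 'Hom(W, U)).
Lemma lfunD f u v : f (u + v) = f u + f v. Proof. exact: linearD. Qed.
Lemma lfunN f u : f (- u) = - f u. Proof. exact: linearN. Qed.
Lemma lfunZ f a u : f (a *: u) = a *: f u. Proof. exact: linearZ. Qed.
Lemma lfun0 f : f 0 = 0. Proof. exact: linear0. Qed.
Lemma Dlfun f g u : (f + g) u = f u + g u. Proof. exact: add_lfunE. Qed.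
Lemma Nlfun f u : (- f) u = - f u. Proof. exact: opp_lfunE. Qed.
Lemma Zlfun a f u : (a *: f) u = a *: f u. Proof. exact: scale_lfunE. Qed.
Lemma zlfun u : (0 : 'Hom(U, V)) u = 0. Proof. exact: zero_lfunE. Qed.
Lemma clfun f h u : (f \o h)%VF u = f (h u). Proof. exact: comp_lfunE. Qed.
End LfunLinear.

Section CoordLinear.
Variables (K : fieldType) (V : vectType K) (n : nat) (X : n.-tuple V).
Variable q : 'I_n.
Lemma coordD u v : coord X q (u + v) = coord X q u + coord X q v.
Proof. exact: linearD. Qed.
Lemma coordN u : coord X q (- u) = - coord X q u.
Proof. exact: linearN. Qed.
Lemma coordZ a u : coord X q (a *: u) = a * coord X q u.
Proof. exact: linearZ. Qed.
Lemma coord0 : coord X q 0 = 0. Proof. exact: linear0. Qed.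
End CoordLinear.

Ltac expand_linear := repeat match goal with
  | |- context [@fun_of_lfun _ _ _ ?f (@Algebra.add _ ?u ?v)] => rewrite (lfunD f u v)
  | |- context [@fun_of_lfun _ _ _ ?f (@Algebra.opp _ ?u)] => rewrite (lfunN f u)
  | |- context [@fun_of_lfun _ _ _ ?f (@GRing.scale _ _ ?a ?u)] => rewrite (lfunZ f a u)
  | |- context [@fun_of_lfun _ _ _ ?f (@Algebra.zero _)] => rewrite (lfun0 f)
  | |- context [@fun_of_lfun _ _ _ (@Algebra.add _ ?f ?g) ?u] => rewrite (Dlfun f g u)
  | |- context [@fun_of_lfun _ _ _ (@Algebra.opp _ ?f) ?u] => rewrite (Nlfun f u)
  | |- context [@fun_of_lfun _ _ _ (@GRing.scale _ _ ?a ?f) ?u] => rewrite (Zlfun a f u)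
  | |- context [@fun_of_lfun _ _ _ (@comp_lfun _ _ _ _ ?f ?g) ?u] => rewrite (clfun f g u)
  | |- context [@fun_of_lfun _ _ _ (@Algebra.zero _) ?u] => rewrite (zlfun _ u)
  end.
Ltac to_scalars :=
  expand_linear; apply: coord_inj => ?;
  rewrite ?(coordD, coordN, coordZ, coord0);
  repeat (move: (coord _ _ _) => ?).
Ltac vlin := to_scalars; ring.

Section SetSpan.
Variables (K : fieldType) (V : vectType K).

Fact ex_setspan (S : V -> Prop) : exists s : seq V,
  (forall v, v \in s -> S v) /\ (forall v, S v -> v \in <<s>>%VS).
Proof.
pose p n :=
  `[< exists2 s : seq V, (forall v, v \in s -> S v) & \dim <<s>> = n >].
have exp : exists n, p n.
  by exists (\dim <<([::] : seq V)>>); apply/asboolP; exists [::].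
have bp n : p n -> (n <= \dim {:V})%N.
  by move=> /asboolP[s _ <-]; apply/dimvS/subvf.
case: (ex_maxnP exp bp) => n /asboolP[s sS sn] maxn.
exists s; split=> // v Sv.
have sub : (<<s>> <= <<v :: s>>)%VS.
  by apply: sub_span => w ws; rewrite inE ws orbT.
have pvs : p (\dim <<v :: s>>).
  apply/asboolP; exists (v :: s) => // w; rewrite inE => /predU1P[->//|].
  exact: sS.
have /eqP -> : (<<s>> == <<v :: s>>)%VS by rewrite eqEdim sub sn maxn.
by apply: memv_span; rewrite mem_head.
Qed.

Definition setspan (S : V -> Prop) : {vspace V} :=
  <<sval (cid (ex_setspan S))>>%VS.

Lemma mem_setspan (S : V -> Prop) v : S v -> v \in setspan S.
Proof. by rewrite /setspan; case: cid => s [_ sS] /= /sS. Qed.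

Lemma setspan_sub (S : V -> Prop) (W : {vspace V}) :
  (forall v, S v -> v \in W) -> (setspan S <= W)%VS.
Proof.
by move=> SW; rewrite /setspan; case: cid => s /= [Ss _]; apply/span_subvP => v /Ss/SW.
Qed.

Lemma setspan_id (S : V -> Prop) :
    S 0 -> (forall a u v, S u -> S v -> S (a *: u + v)) ->
  forall v, reflect (S v) (v \in setspan S).
Proof.
move=> S0 SL v; apply: (iffP idP) => [|/mem_setspan//].
rewrite /setspan; case: cid => s /= [Ss _] vs.
rewrite (@coord_span _ _ _ (in_tuple s) v vs).
elim/big_rec: _ => // i x _ Sx; apply: SL => //.
exact/Ss/mem_nth.
Qed.

End SetSpan.

Record superspace (K : fieldType) := Superspace {
  carrier :> vectType K;
  part : bool -> {vspace carrier};
  part_direct : (part false :&: part true = 0)%VS;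
  part_full : (part false + part true = fullv)%VS }.

Section SuperspaceTheory.
Variables (K : fieldType) (V : superspace K).
Implicit Types (f : 'End(V)) (i r : bool).

Definition homproj i : 'End(V) := daddv_pi (part V i) (part V (~~ i)).

Definition has_degree r f :=
  forall i v, v \in part V i -> f v \in part V (i (+) r).

Definition trace (W : vectType K) (g : 'End(W)) : K :=
  \tr (passmx.mxof (vbasis {:W}) (vbasis {:W}) g).

(* The diagonal block V_i -> V_i of f : V -> V. *)
Definition diagblock i f : 'End(subvs_of (part V i)) :=
  linfun (vsproj (part V i) \o homproj i \o f \o vsval).

Definition supertrace f : K :=
  trace (diagblock false f) - trace (diagblock true f).

Lemma part_capN i : (part V i :&: part V (~~ i) = 0)%VS.
Proof. by case: i; rewrite /= ?part_direct // capvC part_direct. Qed.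

Lemma part_addN i : (part V i + part V (~~ i) = fullv)%VS.
Proof. by case: i; rewrite /= ?part_full // addvC part_full. Qed.

Lemma mem_homproj i v : homproj i v \in part V i.
Proof. exact: memv_pi. Qed.

Lemma homproj_id i v : v \in part V i -> homproj i v = v.
Proof. exact/daddv_pi_id/part_capN. Qed.

Lemma homproj_other i j v : v \in part V i -> j != i -> homproj j v = 0.
Proof.
move=> vi ji; have -> : j = ~~ i by case: i j ji {vi} => [] [].
have e : homproj i v + homproj (~~ i) v = v.
  by rewrite /homproj negbK daddv_pi_add ?part_capN // part_addN memvf.
by apply: (addrI v); rewrite -{1}(homproj_id vi) e addr0.
Qed.

Lemma homproj_sum v : homproj false v + homproj true v = v.
Proof. by apply: daddv_pi_add; rewrite ?part_full ?memvf ?part_direct. Qed.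

Lemma lfun_homP (W : vectType K) (f g : 'Hom(V, W)) :
  (forall i v, v \in part V i -> f v = g v) -> f = g.
Proof.
move=> fg; apply/lfunP => v; rewrite -(homproj_sum v) !lfunD.
by rewrite !(fg _ _ (mem_homproj _ _)).
Qed.

End SuperspaceTheory.

(* The operations are curried linear maps, so that bilinearity of the product
   and trilinearity of the bracket are part of their types. *)
Record bolSuperalgebra (K : fieldType) := BolSuperalgebra {
  superspace_of :> superspace K;
  bmul : 'Hom(superspace_of, 'End(superspace_of));
  btri : 'Hom(superspace_of, 'Hom(superspace_of, 'End(superspace_of)));
  bmul_part : forall i j x y,
    x \in part superspace_of i -> y \in part superspace_of j ->
    bmul x y \in part superspace_of (i (+) j);
  btri_part : forall i j k x y z,
    x \in part superspace_of i -> y \in part superspace_of j ->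
    z \in part superspace_of k ->
    btri x y z \in part superspace_of (i (+) j (+) k);
  BS1 : forall i j x y,
    x \in part superspace_of i -> y \in part superspace_of j ->
    bmul x y = - ((-1) ^+ (i && j) *: bmul y x);
  BS2 : forall i j k x y z,
    x \in part superspace_of i -> y \in part superspace_of j ->
    z \in part superspace_of k ->
    btri x y z = - ((-1) ^+ (i && j) *: btri y x z);
  BS3 : forall i j k x y z,
    x \in part superspace_of i -> y \in part superspace_of j ->
    z \in part superspace_of k ->
    btri x y z + (-1) ^+ (i && (j (+) k)) *: btri y z x
      + (-1) ^+ (k && (i (+) j)) *: btri z x y = 0;
  BS4 : forall i j k l m x y u v w,
    x \in part superspace_of i -> y \in part superspace_of j ->
    u \in part superspace_of k -> v \in part superspace_of l ->
    w \in part superspace_of m ->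
    btri x y (btri u v w)
      = btri (btri x y u) v w
        + (-1) ^+ (k && (i (+) j)) *: btri u (btri x y v) w
        + (-1) ^+ ((i (+) j) && (k (+) l)) *: btri u v (btri x y w);
  BS5 : forall i j k l x y u v,
    x \in part superspace_of i -> y \in part superspace_of j ->
    u \in part superspace_of k -> v \in part superspace_of l ->
    btri x y (bmul u v)
      = (-1) ^+ (k && (i (+) j)) *: bmul u (btri x y v)
        + bmul (btri x y u) v
        + (-1) ^+ ((i (+) j) && (k (+) l)) *: btri u v (bmul x y)
        + bmul (bmul x y) (bmul u v) }.

Section Morphisms.
Variable K : fieldType.

Definition bol_morphism (B C : bolSuperalgebra K) (f : 'Hom(B, C)) :=
  [/\ forall i x, x \in part B i -> f x \in part C i,
      forall x y, f (bmul B x y) = bmul C (f x) (f y)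
    & forall x y z, f (btri B x y z) = btri C (f x) (f y) (f z)].

(* f \in Aut(B) *)
Definition bol_automorphism (B : bolSuperalgebra K) (f : 'End(B)) :=
  bol_morphism f /\ bijective f.

End Morphisms.

Section Enveloping.
Variables (K : fieldType) (B : bolSuperalgebra K).
Local Notation "x '·' y" := (bmul B x y) (at level 40, left associativity).
Local Notation "⟦ x , y , z ⟧" := (btri B x y z).
Local Notation pairs := ('End(B) * B)%type.

(* P is a pseudo superderivation of degree r and a \in Com(P). *)
Definition companion (r : bool) (P : 'End(B)) (a : B) :=
  [/\ has_degree r P, a \in part B r,
      forall i j k x y z,
        x \in part B i -> y \in part B j -> z \in part B k ->
        P ⟦x, y, z⟧ = ⟦P x, y, z⟧ + (-1) ^+ (r && i) *: ⟦x, P y, z⟧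
                       + (-1) ^+ (r && (i (+) j)) *: ⟦x, y, P z⟧
    & forall i j x y, x \in part B i -> y \in part B j ->
        P (x · y) = (-1) ^+ (r && i) *: (x · P y) + P x · y
                    + (-1) ^+ (r && (i (+) j)) *: ⟦x, y, a⟧ + a · (x · y)].

Definition ipS (r : bool) : {vspace 'End(B)} :=
  setspan (fun P => exists i j x y,
    [/\ x \in part B i, y \in part B j, i (+) j = r & P = btri B x y]).

Definition IPSpart (r : bool) : {vspace pairs} :=
  setspan (fun Pc => Pc.1 \in ipS r /\ companion r Pc.1 Pc.2).

Lemma companion0 r : companion r 0 0.
Proof.
split; rewrite ?mem0v //.
- by move=> i v _; rewrite lfunE mem0v.
- by move=> i j k x y z _ _ _; vlin.
- by move=> i j x y _ _; vlin.
Qed.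

Lemma companionP r t P a Q b : companion r P a -> companion r Q b ->
  companion r (t *: P + Q) (t *: a + b).
Proof.
move=> [Pd ar Pt Pm] [Qd br Qt Qm]; split.
- move=> i v vi; rewrite Dlfun Zlfun rpredD ?rpredZ //.
  + exact: Pd.
  + exact: Qd.
- by rewrite rpredD ?rpredZ.
- move=> i j k x y z xi yj zk.
  rewrite Dlfun Zlfun (Pt _ _ _ _ _ _ xi yj zk).
  rewrite (Qt _ _ _ _ _ _ xi yj zk); vlin.
- move=> i j x y xi yj.
  rewrite Dlfun Zlfun (Pm _ _ _ _ xi yj) (Qm _ _ _ _ xi yj); vlin.
Qed.

(* The set spanning IPSpart r is already a subspace. *)
Lemma mem_IPSpart r P c :
  reflect (P \in ipS r /\ companion r P c) ((P, c) \in IPSpart r).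
Proof.
pose S (Pc : pairs) := Pc.1 \in ipS r /\ companion r Pc.1 Pc.2.
suff h (Pc : pairs) : reflect (S Pc) (Pc \in IPSpart r) by exact: h (P, c).
apply: setspan_id; first by split; [exact: mem0v | exact: companion0].
move=> t [P1 c1] [P2 c2] [/= P1i P1c] [/= P2i P2c]; split=> /=.
  by rewrite rpredD ?rpredZ.
exact: companionP.
Qed.

Lemma companion_D i j x y : x \in part B i -> y \in part B j ->
  companion (i (+) j) (btri B x y) (x · y).
Proof.
move=> xi yj; split.
- by move=> k v vk; rewrite addbC; apply: btri_part.
- exact: bmul_part.
- move=> k l m u v w uk vl wm; rewrite (BS4 xi yj uk vl wm).
  by rewrite [k && _]andbC.
- move=> k l u v uk vl; rewrite (BS5 xi yj uk vl).
  by rewrite [k && _]andbC.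
Qed.

Lemma ipS_D i j x y : x \in part B i -> y \in part B j ->
  btri B x y \in ipS (i (+) j).
Proof. by move=> xi yj; apply: mem_setspan; exists i, j, x, y. Qed.

Lemma ipS_comm r s P Q a : companion r P a -> Q \in ipS s ->
  (P \o Q)%VF - (-1) ^+ (r && s) *: (Q \o P)%VF \in ipS (r (+) s).
Proof.
move=> [Pd _ Pt _].
pose f (Q : 'End(B)) := (P \o Q)%VF - (-1) ^+ (r && s) *: (Q \o P)%VF.
have f_lin : linear f.
  by move=> c Q1 Q2; apply/lfunP => v; rewrite /f; vlin.
pose fL := GRing.isLinear.Build _ _ _ _ f f_lin.
pose F : {linear 'End(B) -> 'End(B)} := HB.pack f fL.
suff sub : (ipS s <= linfun F @^-1: ipS (r (+) s))%VS.
  by move=> /(subvP sub); rewrite -memv_preim lfunE.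
apply: setspan_sub => _ [i [j [x [y [xi yj sE ->]]]]].
rewrite -memv_preim lfunE -[X in X \in _]/(f _).
suff -> : f (btri B x y) = btri B (P x) y + (-1) ^+ (r && i) *: btri B x (P y).
  rewrite -sE rpredD ?rpredZ //.
    by rewrite addbA [r (+) i]addbC; apply: ipS_D => //; apply: Pd.
  by rewrite addbCA [r (+) j]addbC; apply: ipS_D => //; apply: Pd.
apply: lfun_homP => k w wk; rewrite /f; expand_linear.
by rewrite (Pt _ _ _ _ _ _ xi yj wk) sE; vlin.
Qed.

Lemma companion_comm r s P Q a b : companion r P a -> companion s Q b ->
  companion (r (+) s) ((P \o Q)%VF - (-1) ^+ (r && s) *: (Q \o P)%VF)
    (P b - (-1) ^+ (r && s) *: Q a - a · b).
Proof.
move=> [Pd ar Pt Pm] [Qd bs Qt Qm]; split.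
- move=> i v vi; expand_linear; rewrite rpredB ?rpredZ //.
    by rewrite [r (+) s]addbC addbA; apply/Pd/Qd.
  by rewrite addbA; apply/Qd/Pd.
- rewrite !rpredB ?rpredZ //.
  + by rewrite addbC; apply: Pd.
  + exact: Qd.
  + exact: bmul_part.
- move=> i j k x y z xi yj zk; expand_linear.
  rewrite (Pt _ _ _ _ _ _ xi yj zk) (Qt _ _ _ _ _ _ xi yj zk); expand_linear.
  rewrite (Pt _ _ _ _ _ _ (Qd _ _ xi) yj zk) (Pt _ _ _ _ _ _ xi (Qd _ _ yj) zk).
  rewrite (Pt _ _ _ _ _ _ xi yj (Qd _ _ zk)) (Qt _ _ _ _ _ _ (Pd _ _ xi) yj zk).
  rewrite (Qt _ _ _ _ _ _ xi (Pd _ _ yj) zk) (Qt _ _ _ _ _ _ xi yj (Pd _ _ zk)).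
  to_scalars; clear.
  by case: i j r s => [] [] [] [] /=; rewrite ?expr0 ?expr1; ring.
- move=> i j x y xi yj; expand_linear.
  have xyij := bmul_part xi yj.
  rewrite (Pm _ _ _ _ xi yj) (Qm _ _ _ _ xi yj); expand_linear.
  rewrite (Pm _ _ _ _ (Qd _ _ xi) yj) (Pm _ _ _ _ xi (Qd _ _ yj)).
  rewrite (Qm _ _ _ _ (Pd _ _ xi) yj) (Qm _ _ _ _ xi (Pd _ _ yj)).
  rewrite (Pm _ _ _ _ bs xyij) (Qm _ _ _ _ ar xyij).
  rewrite (Pt _ _ _ _ _ _ xi yj bs) (Qt _ _ _ _ _ _ xi yj ar).
  rewrite (Pm _ _ _ _ xi yj) (Qm _ _ _ _ xi yj).
  expand_linear; rewrite (BS5 xi yj ar bs) (BS1 (btri_part xi yj ar) bs).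
  rewrite (BS1 xyij (bmul_part ar bs)) (BS2 ar xyij bs).
  have /eqP := BS3 ar bs xyij; rewrite -addrA addr_eq0 => /eqP ->.
  to_scalars; clear.
  by case: i j r s => [] [] [] [] /=; rewrite ?expr0 ?expr1; ring.
Qed.

Definition IPS : {vspace pairs} := (IPSpart false + IPSpart true)%VS.

(* L(B) = B + IPS(B,B), with L(B)_i = B_i + IPS_i(B,B). *)
Local Notation Lcarrier := (B * subvs_of IPS)%type.

Definition Lpart i : {vspace Lcarrier} :=
  (linfun fst @^-1: part B i :&: linfun (vsval \o snd) @^-1: IPSpart i)%VS.

Lemma mem_Lpart i (u : Lcarrier) :
  (u \in Lpart i) = (u.1 \in part B i) && (vsval u.2 \in IPSpart i).
Proof. by rewrite memv_cap -!memv_preim !lfunE. Qed.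

Lemma companion_uniq P a b :
  companion false P a -> companion true P b -> P = 0.
Proof.
move=> [P0 _ _ _] [P1 _ _ _]; apply: lfun_homP => i v vi; rewrite lfunE /=.
apply/eqP; rewrite -memv0 -(part_capN B i) memv_cap.
by have := P0 _ _ vi; have := P1 _ _ vi; rewrite addbT addbF => -> ->.
Qed.

Fact Lpart_direct : (Lpart false :&: Lpart true = 0)%VS.
Proof.
apply/eqP; rewrite -subv0; apply/subvP => -[x [[P c] Pc]].
rewrite memv_cap !mem_Lpart /= memv0 => /andP[/andP[x0 /mem_IPSpart[_ P0]]].
move=> /andP[x1 /mem_IPSpart[_ P1]].
apply/eqP; congr (_, _).
  by apply/eqP; rewrite -memv0 -(part_direct B) memv_cap x0.
apply/val_inj => /=; congr (_, _); first exact: companion_uniq P0 P1.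
case: P0 P1 => _ c0 _ _ [_ c1 _ _].
by apply/eqP; rewrite -memv0 -(part_direct B) memv_cap c0.
Qed.

Fact Lpart_full : (Lpart false + Lpart true = fullv)%VS.
Proof.
apply/eqP; rewrite eqEsubv subvf; apply/subvP => -[x q] _.
have /memv_addP[q0 q0P [q1 q1P qE]] := subvsP q.
have q0I : q0 \in IPS by apply: subvP q0P; exact: addvSl.
have q1I : q1 \in IPS by apply: subvP q1P; exact: addvSr.
have -> : (x, q) = (homproj B false x, vsproj IPS q0)
                   + (homproj B true x, vsproj IPS q1).
  congr (_, _); first by rewrite homproj_sum.
  by apply/val_inj; rewrite /= !vsprojK.
by apply: memv_add; rewrite mem_Lpart /= mem_homproj vsprojK.
Qed.

Definition envelope : superspace K := Superspace Lpart_direct Lpart_full.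

(* The IPS(B,B)-component of the bracket of u \in L(B)_i and v \in L(B)_j. *)
Definition hombracket_IPS i j (u v : envelope) : pairs :=
  let: (x, (P, a)) := (u.1, vsval u.2) in
  let: (y, (Q, b)) := (v.1, vsval v.2) in
  (btri B x y + ((P \o Q)%VF - (-1) ^+ (i && j) *: (Q \o P)%VF),
   x · y + (P b - (-1) ^+ (i && j) *: Q a - a · b)).

Lemma mem_hombracket_IPS i j u v :
    u \in part envelope i -> v \in part envelope j ->
  hombracket_IPS i j u v \in IPSpart (i (+) j).
Proof.
case: u v => [x [[P a] Pa]] [y [[Q b] Qb]].
rewrite !mem_Lpart /= => /andP[xi /mem_IPSpart[Pi Pc]].
move=> /andP[yj /mem_IPSpart[Qj Qc]].
apply/mem_IPSpart; split.
  by rewrite rpredD ?ipS_D // (ipS_comm Pc).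
rewrite -[btri B x y]scale1r -[x · y]scale1r.
apply: companionP; [exact: companion_D | exact: companion_comm].
Qed.

(* The bracket of u \in L(B)_i and v \in L(B)_j; vsproj only retypes the
   second component, by [mem_hombracket_IPS]. *)
Definition hombracket i j (u v : envelope) : envelope :=
  ((vsval u.2).1 v.1 - (-1) ^+ (i && j) *: (vsval v.2).1 u.1,
   vsproj IPS (hombracket_IPS i j u v)).

Lemma hombracket_linear i j u : linear (hombracket i j u).
Proof.
case: u => x [[P a] Pa] c [y [[Q b] Qb]] [z [[R e] Re]].
congr (_, _); rewrite /=; first by vlin.
rewrite -linearP; congr (vsproj _ _); congr (_, _) => /=.
  by apply/lfunP => t; vlin.
by vlin.
Qed.

Definition bracket (u v : envelope) : envelope :=
  \sum_(i : bool) \sum_(j : bool)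
    hombracket i j (homproj envelope i u) (homproj envelope j v).

HB.instance Definition _ i j u := GRing.isLinear.Build K envelope envelope _
  (hombracket i j u) (hombracket_linear i j u).

Lemma bracket_hom i j u v :
    u \in part envelope i -> v \in part envelope j ->
  bracket u v = hombracket i j u v.
Proof.
move=> ui vj; rewrite /bracket (bigD1 i) //= (bigD1 j) //=.
rewrite (homproj_id ui) (homproj_id vj) !big1 ?addr0 // => k ki.
  apply: big1 => l _; rewrite (homproj_other ui ki).
  case: (homproj _ l v) => y [[Q b] Qb]; congr (_, _) => /=.
    by vlin.
  rewrite -[RHS](linear0 (vsproj IPS)); congr (vsproj _ _); congr (_, _) => /=.
    by apply/lfunP => t; vlin.
  by vlin.
by rewrite (homproj_other vj ki) linear0.
Qed.

Lemma bracket_linear u : linear (bracket u).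
Proof.
move=> c v w; rewrite /bracket scaler_sumr -big_split /=.
apply: eq_bigr => i _; rewrite scaler_sumr -big_split /=.
by apply: eq_bigr => j _; rewrite linearP hombracket_linear.
Qed.

HB.instance Definition _ u :=
  GRing.isLinear.Build K envelope envelope _ (bracket u) (bracket_linear u).

Definition ad (u : envelope) : 'End(envelope) := linfun (bracket u).

Lemma adE u v : ad u v = bracket u v.
Proof. exact: lfunE. Qed.

Definition killing_form (u v : envelope) : K := supertrace (ad u \o ad v)%VF.

Definition killing_ricci (x y : B) : K := killing_form (x, 0) (y, 0).

End Enveloping.

(* Main.v *)
From HB Require Import structures.
Require Import Defs.
From mathcomp Require Import all_boot all_order all_algebra.
From mathcomp Require Import ring.

Set Implicit Arguments.
Unset Strict Implicit.
Unset Printing Implicit Defensive.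

Import GRing.Theory.
Local Open Scope ring_scope.

(** The Killing-Ricci form is a supertrace form, and the four properties come
    from four properties of the supertrace on End(L), L = L(B).

    Cutting a trace into diagonal blocks gives
    str f = tr (p_0 f) - tr (p_1 f), with p_i the projection of L onto L_i
    ([supertraceE]). Since f p_i = p_(i + r) f for f of degree r, cyclicity of
    the trace yields
      - str (f g) = (-1)^(rs) str (g f) for f, g of degrees r, s
        ([supertraceC]), which is supersymmetry, as ad u has the degree of u;
      - str f = 0 for odd f ([supertrace_odd]), hence beta(B_0, B_1) = 0;
      - invariance of str under conjugation by an even automorphism
        ([supertrace_conj]). An automorphism A of B extends to the
        automorphism (x, (P, a)) |-> (A x, (A P A^-1, A a)) of L
        ([bracket_transport]), which conjugates ad x into ad (A x);
      - invariance of (f, g) |-> str (f g) under supercommutators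
        ([supertrace_invariant]). If (P, a) is in IPS(B, B), then P x is the
        bracket [(P, a), x] in L, and ad (P x) is the supercommutator of
        ad (P, a) and ad x ([ad_apply]): this is the instance of the super
        Jacobi identity that is needed, and it amounts to P being a
        pseudo superderivation with companion a. So beta is invariant under P
        ([killing_ricci_companion]), in particular under P = D_(x, y), whose
        companion is xy. *)

(** * Traces of endomorphisms *)

Section Trace.
Context {K : fieldType}.

Lemma mxof_vbasis_comp {U V W : vectType K} (f : 'Hom(U, V)) (g : 'Hom(V, W)) :
  passmx.mxof (vbasis {:U}) (vbasis {:W}) (g \o f)%VF
  = passmx.mxof (vbasis {:U}) (vbasis {:V}) f
    *m passmx.mxof (vbasis {:V}) (vbasis {:W}) g.
Proof. by apply: passmx.mxof_comp; apply: vbasisP. Qed.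

Lemma traceC {U V : vectType K} (f : 'Hom(U, V)) (g : 'Hom(V, U)) :
  trace (f \o g)%VF = trace (g \o f)%VF.
Proof. by rewrite /trace !mxof_vbasis_comp mxtrace_mulC. Qed.

Lemma traceP (V : vectType K) (c : K) (f g : 'End(V)) :
  trace (c *: f + g) = c * trace f + trace g.
Proof. by rewrite /trace passmx.mxof_linear linearP. Qed.

Lemma trace0 (V : vectType K) : trace (0 : 'End(V)) = 0.
Proof. by have := @traceP V (-1) 0 0; rewrite scaler0 addr0 mulN1r addNr. Qed.

End Trace.

(** * The supertrace *)

Section Supertrace.
Context {K : fieldType} {V : superspace K}.
Implicit Types (f g h : 'End(V)) (i r s : bool).

Lemma trace_diagblock i f : trace (diagblock i f) = trace (homproj V i \o f)%VF.
Proof.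
pose p : 'Hom(V, subvs_of (part V i))
  := linfun (vsproj (part V i) \o homproj V i).
pose e : 'Hom(subvs_of (part V i), V) := linfun vsval.
have -> : diagblock i f = ((p \o f) \o e)%VF.
  by apply/lfunP => v; rewrite !comp_lfunE !lfunE.
rewrite [LHS]traceC comp_lfunA; congr (trace (_ \o _)%VF).
apply/lfunP => v; rewrite !comp_lfunE !lfunE /= vsprojK //; exact: mem_homproj.
Qed.

Lemma supertraceE f :
  supertrace f = trace (homproj V false \o f)%VF - trace (homproj V true \o f)%VF.
Proof. by rewrite /supertrace !trace_diagblock. Qed.

Lemma supertraceP c f g :
  supertrace (c *: f + g) = c * supertrace f + supertrace g.
Proof. by rewrite !supertraceE !comp_lfunDr -!comp_lfunZr !traceP; ring. Qed.

Lemma homproj_degree r f i v :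
  has_degree r f -> homproj V i (f v) = f (homproj V (i (+) r) v).
Proof.
move=> fr; rewrite -{1}(homproj_sum v) !lfunD.
have E k : homproj V i (f (homproj V k v))
           = if k == i (+) r then f (homproj V k v) else 0.
  have fk := fr _ _ (mem_homproj k v).
  case: eqP => [ki|/eqP ki]; first by rewrite homproj_id // -[i](addbK r) -ki.
  by apply: homproj_other fk _; apply: contraNneq ki => ->; rewrite addbK.
by rewrite !E; case: i r {fr E} => [] [] /=; rewrite ?addr0 ?add0r.
Qed.

Lemma supertrace_odd f : has_degree true f -> supertrace f = 0.
Proof.
move=> fr; rewrite supertraceE.
suff E i : trace (homproj V i \o f)%VF = 0 by rewrite !E subrr.
(* p_i f = p_i (p_i f) has the trace of p_i f p_i, which is 0 for odd f. *)
have -> : (homproj V i \o f)%VF = (homproj V i \o (homproj V i \o f))%VF.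
  by apply/lfunP => v; rewrite !comp_lfunE (homproj_id (mem_homproj _ _)).
rewrite traceC; have -> : ((homproj V i \o f) \o homproj V i)%VF = 0.
  apply/lfunP => v; rewrite !comp_lfunE zero_lfunE.
  apply: homproj_other (fr _ _ (mem_homproj i v)) _.
  by rewrite addbT; case: i.
exact: trace0.
Qed.

Lemma has_degree_comp r s f g :
  has_degree r f -> has_degree s g -> has_degree (r (+) s) (f \o g)%VF.
Proof.
move=> fr gs i v vi; rewrite comp_lfunE [r (+) s]addbC addbA.
by apply: fr; apply: gs.
Qed.

Lemma trace_homproj_degree r f g i : has_degree r f ->
  trace (homproj V i \o (f \o g))%VF = trace (homproj V (i (+) r) \o (g \o f))%VF.
Proof.
move=> fr; have -> : (homproj V i \o (f \o g))%VF
                     = (f \o (homproj V (i (+) r) \o g))%VF.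
  by apply/lfunP => v; rewrite !comp_lfunE (homproj_degree _ _ fr).
by rewrite traceC comp_lfunA.
Qed.

(** If the degrees differ, then both supertraces vanish; if they are equal, the
    sign is produced by moving f across the two projections. *)
Lemma supertraceC r s f g : has_degree r f -> has_degree s g ->
  supertrace (f \o g)%VF = (-1) ^+ (r && s) * supertrace (g \o f)%VF.
Proof.
move=> fr gs; case: (boolP (r (+) s)) => [rs|].
  rewrite !supertrace_odd ?mulr0 // -rs; last exact: has_degree_comp.
  by rewrite addbC; apply: has_degree_comp.
rewrite negb_add => /eqP rs; subst s; rewrite andbb !supertraceE.
rewrite !(trace_homproj_degree g _ fr).
by case: r fr gs => _ _; rewrite ?expr0 ?expr1 /=; ring.
Qed.

Lemma supertrace_conj f g h : has_degree false g -> (h \o g)%VF = \1%VF ->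
  supertrace (g \o (f \o h))%VF = supertrace f.
Proof.
move=> g0 hg; rewrite !supertraceE !(trace_homproj_degree _ _ g0) !addbF.
by rewrite -!(comp_lfunA f) hg comp_lfun1r.
Qed.

(** Writing [h, f] for the supercommutator,
    str ([h, f] g) = - (-1)^(rk) str (f [h, g]). *)
Lemma supertrace_invariant r k l (h f g : 'End(V)) :
    has_degree r h -> has_degree k f -> has_degree l g ->
  supertrace ((h \o f - (-1) ^+ (r && k) *: (f \o h)) \o g)%VF
  = - ((-1) ^+ (r && k)
       * supertrace (f \o (h \o g - (-1) ^+ (r && l) *: (g \o h)))%VF).
Proof.
move=> hr fk gl.
have -> : ((h \o f - (-1) ^+ (r && k) *: (f \o h)) \o g)%VF
        = - (-1) ^+ (r && k) *: (f \o (h \o g))%VF + (h \o (f \o g))%VF.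
  by apply/lfunP => v; expand_linear; rewrite scaleNr addrC.
have -> : (f \o (h \o g - (-1) ^+ (r && l) *: (g \o h)))%VF
        = - (-1) ^+ (r && l) *: ((f \o g) \o h)%VF + (f \o (h \o g))%VF.
  by apply/lfunP => v; expand_linear; rewrite scaleNr addrC.
rewrite !supertraceP (supertraceC hr (has_degree_comp fk gl)).
clear; case: r k l => [] [] [] /=; rewrite ?expr0 ?expr1; ring.
Qed.

End Supertrace.

(** * Adjoint maps in the enveloping superalgebra *)

Section Bracket.
Context {K : fieldType} {B : bolSuperalgebra K}.
Local Notation L := (envelope B).
Implicit Types (u v : L) (x y z : B) (q : subvs_of (IPS B)) (i j k r : bool).

Lemma IPSpart_sub r p : p \in IPSpart B r -> p \in IPS B.
Proof.
case: r => pr; first exact: (subvP (addvSr _ _)) pr.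
exact: (subvP (addvSl _ _)) pr.
Qed.

Lemma mem_Lpart_base i x : x \in part B i -> ((x, 0) : L) \in part L i.
Proof. by move=> xi; rewrite mem_Lpart /= xi mem0v. Qed.

Lemma ad_degree i u : u \in part L i -> has_degree i (ad u).
Proof.
move=> ui j v vj; rewrite adE (bracket_hom ui vj).
have q := mem_hombracket_IPS ui vj.
rewrite addbC mem_Lpart /= vsprojK ?(IPSpart_sub q) // q andbT.
move: u v ui vj {q} => [x [[P a] Pa]] [y [[Q b] Qb]].
rewrite !mem_Lpart /= => /andP[xi /mem_IPSpart[_ [Pi _ _ _]]].
move=> /andP[yj /mem_IPSpart[_ [Qj _ _ _]]].
rewrite rpredB ?rpredZ //; first by rewrite addbC; apply: Pi.
exact: Qj.
Qed.

(** The IPS(B, B)-component of the bracket, without the retyping [vsproj]. *)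
Lemma vsval_bracket i j u v : u \in part L i -> v \in part L j ->
  vsval (bracket u v).2 = hombracket_IPS i j u v.
Proof.
move=> ui vj; rewrite (bracket_hom ui vj) /= vsprojK //.
exact: IPSpart_sub (mem_hombracket_IPS ui vj).
Qed.

Lemma envelope_eq u v : u.1 = v.1 -> vsval u.2 = vsval v.2 -> u = v.
Proof. by case: u v => [x q] [y q'] /= -> /val_inj ->. Qed.

(** The super Jacobi identity for h = (P, a) in IPS(B, B) and z in B: as
    [h, z] = P z, it reads ad (P z) = [ad h, ad z]. *)
Lemma ad_apply r k (P : 'End(B)) (a : B) (h : L) z :
    h.1 = 0 -> vsval h.2 = (P, a) -> h \in part L r -> z \in part B k ->
  ad ((P z, 0) : L) = (ad h \o ad ((z, 0) : L))%VF
                    - (-1) ^+ (r && k) *: (ad ((z, 0) : L) \o ad h)%VF.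
Proof.
move=> h0 hP hr zk.
have := hr; rewrite mem_Lpart h0 hP /= => /andP[_ /mem_IPSpart[_ Pc]].
have [Pd ar Pt Pm] := Pc.
apply: (@lfun_homP _ L) => m w wm.
have := wm; rewrite mem_Lpart => /andP[w1 _].
have zL := mem_Lpart_base zk.
have PzL : ((P z, 0) : L) \in part L (r (+) k).
  by rewrite addbC; apply: mem_Lpart_base; apply: Pd.
have zwL := ad_degree zL wm; have hwL := ad_degree hr wm.
rewrite adE in zwL; rewrite adE in hwL.
expand_linear; rewrite !adE.
case wE: (vsval w.2) => [Q b].
have hwE : hombracket_IPS r m h w = ((P \o Q)%VF - (-1) ^+ (r && m) *: (Q \o P)%VF,
   P b - (-1) ^+ (r && m) *: Q a - bmul B a b).
  rewrite /hombracket_IPS h0 hP wE; congr (_, _).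
    by apply/lfunP => t; vlin.
  by vlin.
have zwE : hombracket_IPS k m ((z, 0) : L) w = (btri B z w.1, bmul B z w.1).
  rewrite /hombracket_IPS wE /=; congr (_, _).
    by apply/lfunP => t; vlin.
  by vlin.
apply: envelope_eq.
  (* B-component: the terms in P (Q z) cancel and Q (P z) remains. *)
  rewrite (bracket_hom PzL wm) (bracket_hom hr zwL) (bracket_hom zL hwL) /=.
  rewrite !(vsval_bracket zL wm, vsval_bracket hr wm) hwE zwE /=.
  rewrite (bracket_hom zL wm) (bracket_hom hr wm) /= hP wE h0 /=.
  to_scalars; clear.
  by case: r k m => [] [] [] /=; rewrite ?expr0 ?expr1; ring.
rewrite linearB linearZ /=.
rewrite (vsval_bracket PzL wm) (vsval_bracket hr zwL) (vsval_bracket zL hwL).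
rewrite /hombracket_IPS.
rewrite (vsval_bracket zL wm) (vsval_bracket hr wm) hwE zwE wE hP h0 /=.
rewrite (bracket_hom zL wm) (bracket_hom hr wm) /= hP wE h0 /=.
have subE c (P1 P2 : 'End(B)) (c1 c2 : B) :
  (P1, c1) + c *: - (P2, c2) = (P1 + c *: - P2, c1 + c *: - c2) by [].
(* IPS(B, B)-component: the two identities defining a pseudo superderivation,
   that for the product and then that for the triple operation. *)
rewrite subE; congr (_, _); last first.
  rewrite (Pm _ _ _ _ zk w1); to_scalars; clear.
  by case: r k m => [] [] [] /=; rewrite ?expr0 ?expr1; ring.
apply: lfun_homP => l t tl; expand_linear; rewrite (Pt _ _ _ _ _ _ zk w1 tl).
to_scalars; clear.
by case: r k m => [] [] [] /=; rewrite ?expr0 ?expr1; ring.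
Qed.

Lemma killing_formC i j u v : u \in part L i -> v \in part L j ->
  killing_form u v = (-1) ^+ (i && j) * killing_form v u.
Proof. by move=> ui vj; apply: supertraceC; apply: ad_degree. Qed.

Lemma killing_form_even_odd u v :
  u \in part L false -> v \in part L true -> killing_form u v = 0.
Proof.
move=> u0 v1; apply: supertrace_odd.
exact: has_degree_comp (ad_degree u0) (ad_degree v1).
Qed.

(** The Killing-Ricci form is invariant under the pseudo superderivations
    lying in ipS(B, B). *)
Lemma killing_ricci_companion r k l P a z y :
    (P, a) \in IPSpart B r -> z \in part B k -> y \in part B l ->
  killing_ricci (P z) y = - ((-1) ^+ (r && k) * killing_ricci z (P y)).
Proof.
move=> Pa zk yl; pose h : L := (0, vsproj (IPS B) (P, a)).
have hP : vsval h.2 = (P, a) by rewrite vsprojK // (IPSpart_sub Pa).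
have hr : h \in part L r by rewrite mem_Lpart hP Pa mem0v.
have zL := ad_degree (mem_Lpart_base zk).
have yL := ad_degree (mem_Lpart_base yl).
rewrite /killing_ricci /killing_form.
rewrite (ad_apply (erefl : h.1 = 0) hP hr zk).
rewrite (ad_apply (erefl : h.1 = 0) hP hr yl).
exact: supertrace_invariant (ad_degree hr) zL yL.
Qed.

End Bracket.

(** * Extension of automorphisms to the enveloping superalgebra *)

Section Automorphism.
Context {K : fieldType} {B : bolSuperalgebra K}.

Lemma bol_automorphism_inv (A : 'End(B)) : bol_automorphism A ->
  exists A' : 'End(B), [/\ bol_morphism A', cancel A A' & cancel A' A].
Proof.
move=> [[Ap Am At] Abij]; have kA : lker A == 0%VS by apply/lker0P/bij_inj.
have AK : cancel A A^-1%VF.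
  by move=> x; rewrite -comp_lfunE lker0_compVf // id_lfunE.
have KA : cancel A^-1%VF A.
  by move=> x; rewrite -comp_lfunE lker0_compfV // id_lfunE.
exists A^-1%VF; split=> //; split.
- move=> i x xi; have Ad : has_degree false A by move=> j v vj; rewrite addbF Ap.
  (* A commutes with the projections onto B_0 and B_1. *)
  have := homproj_degree i (A^-1%VF x) Ad.
  rewrite KA homproj_id // addbF => xE; rewrite xE AK; exact: mem_homproj.
- by move=> x y; apply: (can_inj AK); rewrite Am !KA.
- by move=> x y z; apply: (can_inj AK); rewrite At !KA.
Qed.

End Automorphism.

Section Transport.
Context {K : fieldType} {B : bolSuperalgebra K}.
Local Notation L := (envelope B).

Variables A A' : 'End(B).
Hypotheses (morA : bol_morphism A) (morA' : bol_morphism A').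
Hypotheses (AK : cancel A A') (KA : cancel A' A).

(** Conjugation by A, with A' the inverse of A. *)
Definition conjL (P : 'End(B)) : 'End(B) := (A \o (P \o A'))%VF.

Lemma conjL_linear : linear conjL.
Proof. by move=> c P Q; apply/lfunP => v; rewrite /conjL; vlin. Qed.

HB.instance Definition _ :=
  GRing.isLinear.Build K 'End(B) 'End(B) _ conjL conjL_linear.

Lemma companion_conjL r P a : companion r P a -> companion r (conjL P) (A a).
Proof.
move: morA morA' => [Ap Am At] [A'p A'm A't] [Pd ar Pt Pm]; split.
- by move=> i v vi; rewrite !comp_lfunE; apply/Ap/Pd/A'p.
- exact: Ap.
- move=> i j k x y z xi yj zk; rewrite !comp_lfunE A't.
  rewrite (Pt _ _ _ _ _ _ (A'p _ _ xi) (A'p _ _ yj) (A'p _ _ zk)).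
  by rewrite !lfunD !lfunZ !At !KA.
- move=> i j x y xi yj; rewrite !comp_lfunE A'm.
  rewrite (Pm _ _ _ _ (A'p _ _ xi) (A'p _ _ yj)).
  by rewrite !lfunD !lfunZ !At !Am !KA.
Qed.

Lemma conjL_btri x y : conjL (btri B x y) = btri B (A x) (A y).
Proof.
by apply/lfunP => z; case: morA => _ _ At; rewrite !comp_lfunE At KA.
Qed.

Lemma mem_ipS_conjL r P : P \in ipS B r -> conjL P \in ipS B r.
Proof.
suff sub : (ipS B r <= linfun conjL @^-1: ipS B r)%VS.
  by move=> /(subvP sub); rewrite -memv_preim lfunE.
apply: setspan_sub => _ [i [j [x [y [xi yj <- ->]]]]].
case: morA => Ap _ _.
by rewrite -memv_preim lfunE /= conjL_btri ipS_D ?Ap.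
Qed.

(** The action of A on pairs (pseudo superderivation, companion). *)
Definition transport_IPS (p : 'End(B) * B) : 'End(B) * B := (conjL p.1, A p.2).

Lemma mem_IPSpart_transport r p :
  p \in IPSpart B r -> transport_IPS p \in IPSpart B r.
Proof.
case: p => P a /mem_IPSpart[Pr Pa]; apply/mem_IPSpart; split.
  exact: mem_ipS_conjL.
exact: companion_conjL.
Qed.

Lemma transport_IPS_linear : linear transport_IPS.
Proof.
move=> c [P a] [Q b]; congr (_, _); first exact: linearP.
by rewrite /= lfunD lfunZ.
Qed.

HB.instance Definition _ := GRing.isLinear.Build K
  ('End(B) * B)%type ('End(B) * B)%type _ transport_IPS transport_IPS_linear.

Lemma mem_IPS_transport p : p \in IPS B -> transport_IPS p \in IPS B.
Proof.
move=> /memv_addP[p0 p0I [p1 p1I ->]]; rewrite linearD.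
by apply: memv_add; apply: mem_IPSpart_transport.
Qed.

(** The extension of A to L(B); [vsproj] only retypes the second component, by
    [mem_IPS_transport]. *)
Definition transport (u : L) : L :=
  (A u.1, vsproj (IPS B) (transport_IPS (vsval u.2))).

Lemma transport_linear : linear transport.
Proof.
move=> c u v; congr (_, _); first by rewrite /= lfunD lfunZ.
by rewrite [vsval _](linearP vsval) transport_IPS_linear linearP.
Qed.

HB.instance Definition _ :=
  GRing.isLinear.Build K L L _ transport transport_linear.

Lemma vsval_transport u : vsval (transport u).2 = transport_IPS (vsval u.2).
Proof. by rewrite vsprojK // mem_IPS_transport ?subvsP. Qed.

Lemma transport_part i u : u \in part L i -> transport u \in part L i.
Proof.
rewrite !mem_Lpart vsval_transport => /andP[ui uI].
by case: morA => Ap _ _; rewrite Ap //= mem_IPSpart_transport.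
Qed.

Lemma hombracket_transport i j u v : u \in part L i -> v \in part L j ->
  hombracket i j (transport u) (transport v) = transport (hombracket i j u v).
Proof.
case: morA => _ Am _ ui vj; rewrite /hombracket.
have wI := IPSpart_sub (mem_hombracket_IPS ui vj).
have TwI := IPSpart_sub
  (mem_hombracket_IPS (transport_part ui) (transport_part vj)).
apply: envelope_eq; rewrite !vsval_transport.
  by rewrite /= !comp_lfunE !AK lfunD lfunN lfunZ.
rewrite [X in _ = transport_IPS X]/= !vsprojK //.
rewrite /hombracket_IPS !vsval_transport.
case: u v {ui vj wI TwI} => [x [[P a] Pa]] [y [[Q b] Qb]] /=.
congr (_, _) => /=.
  rewrite -conjL_btri; apply/lfunP => t; rewrite /conjL; expand_linear.
  by rewrite !AK.
by rewrite /= !lfunD !lfunN !lfunZ !Am !comp_lfunE !AK.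
Qed.

Lemma bracket_transport u v :
  bracket (transport u) (transport v) = transport (bracket u v).
Proof.
have Td : has_degree false (linfun transport : 'End(L)).
  by move=> i w wi; rewrite lfunE addbF; apply: transport_part.
rewrite /bracket linear_sum; apply: eq_bigr => i _.
rewrite linear_sum; apply: eq_bigr => j _.
have := homproj_degree i u Td; have := homproj_degree j v Td.
rewrite !lfunE !addbF /= => -> ->.
by apply: hombracket_transport; apply: mem_homproj.
Qed.

End Transport.

(** * Invariance properties of the Killing-Ricci form *)

Section KillingAutomorphism.
Context {K : fieldType} {B : bolSuperalgebra K}.
Local Notation L := (envelope B).

Lemma transportK (A A' : 'End(B)) : bol_morphism A -> bol_morphism A' ->
  cancel A A' -> cancel A' A -> cancel (transport A A') (transport A' A).
Proof.
move=> mA mA' AK KA u; apply: envelope_eq; first exact: AK.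
rewrite !vsval_transport //; case: u => x [[P a] Pa]; congr (_, _) => /=.
  by apply/lfunP => t; rewrite !comp_lfunE !AK.
exact: AK.
Qed.

Lemma killing_ricci_automorphism (A : 'End(B)) (x y : B) : bol_automorphism A ->
  killing_ricci (A x) (A y) = killing_ricci x y.
Proof.
move=> autA; have [A' [mA' AK KA]] := bol_automorphism_inv autA.
have [mA _] := autA.
pose T : 'End(L) := linfun (transport A A').
pose T' : 'End(L) := linfun (transport A' A).
have TK : (T' \o T)%VF = \1%VF.
  by apply/lfunP => u; rewrite comp_lfunE id_lfunE !lfunE /= transportK.
have T0 : has_degree false T.
  by move=> i u ui; rewrite lfunE addbF; apply: transport_part.
have TE z : ((A z, 0) : L) = transport A A' (z, 0).
  by rewrite /transport !linear0.
have adT u : ad (transport A A' u) = (T \o (ad u \o T'))%VF.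
  apply/lfunP => v; rewrite !comp_lfunE !lfunE /= -bracket_transport //.
  by rewrite transportK.
rewrite /killing_ricci /killing_form !TE !adT.
rewrite -(supertrace_conj (ad (x, 0) \o ad (y, 0))%VF T0 TK).
congr supertrace; apply/lfunP => v; rewrite !comp_lfunE.
by rewrite -[T' (T _)]comp_lfunE TK id_lfunE.
Qed.

End KillingAutomorphism.

Theorem proposition4p4 (K : fieldType) (hK : [pchar K] =i pred0)
    (B : bolSuperalgebra K) :
  let beta := @killing_ricci K B in
  [/\ forall (i j : bool) (x y : B), x \in part B i -> y \in part B j ->
        beta x y = (-1) ^+ (i && j) * beta y x,
      forall x y : B, x \in part B false -> y \in part B true -> beta x y = 0,
      forall A : 'End(B), bol_automorphism A ->
        forall x y : B, beta (A x) (A y) = beta x y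
    & forall (i j k l : bool) (x y z u : B),
        x \in part B i -> y \in part B j -> z \in part B k -> u \in part B l ->
        beta (btri B x y z) u
          = - ((-1) ^+ (k && (i (+) j)) * beta z (btri B x y u))].
Proof.
move=> beta; split.
- by move=> i j x y xi yj; apply: killing_formC; apply: mem_Lpart_base.
- by move=> x y x0 y1; apply: killing_form_even_odd; apply: mem_Lpart_base.
- by move=> A autA x y; apply: killing_ricci_automorphism.
- move=> i j k l x y z u xi yj zk ul; rewrite [k && _]andbC.
  apply: killing_ricci_companion zk ul.
  by apply/mem_IPSpart; split; [apply: ipS_D | apply: companion_D].
Qed.
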